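(* Let $A,E\in\mathbb{R}^{m\times n}$ and let $P\in\mathbb{R}^{m\times m}$ be an orthogonal projector, i.e. $P^2=P=P^T$. Then for every Schatten $p$-norm $\|\cdot\|_{(p)}$, $$\Big|\,\|(I-P)(A+E)\|_{(p)}-\|(I-P)A\|_{(p)}\,\Big|\ \le\ \|E\|_{(p)}.$$
   Context: For a real matrix $M\in\mathbb{R}^{m\times n}$ with singular values $\sigma_1(M)\ge\dots\ge\sigma_r(M)\ge 0$, $r=\min\{m,n\}$, the Schatten $p$-norm is $\|M\|_{(p)}=\left(\sum_{j=1}^r\sigma_j(M)^p\right)^{1/p}$ for integers $p\ge1$, and $\|M\|_{(\infty)}=\|M\|_2=\sigma_1(M)$ for $p=\infty$. *)

(* Defs.v *)
From HB Require Import structures.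
From mathcomp Require Import all_boot all_order all_algebra.
From mathcomp Require Import reals exp.
From mathcomp Require Import polyrcf.

Set Implicit Arguments.
Unset Strict Implicit.
Unset Printing Implicit Defensive.

Import Order.TTheory GRing.Theory Num.Theory.
Local Open Scope ring_scope.

(* [rootsR] lists each real root once, in increasing order; [mup] restores the
   algebraic multiplicities.  For a symmetric matrix this is the full spectrum. *)
Definition real_eigenvalues (R : realType) (n : nat) (A : 'M[R]_n) : seq R :=
  flatten [seq nseq (mup x (char_poly A)) x | x <- rootsR (char_poly A)].

(* M^T M is n x n, with n eigenvalues counted with multiplicity, of which at
   most minn m n are nonzero; the remaining ones are not singular values. *)
Definition singular_values (R : realType) (m n : nat) (M : 'M[R]_(m, n)) :
    seq R :=
  take (minn m n) (rev [seq Num.sqrt x | x <- real_eigenvalues (M^T *m M)]).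

(* Indices start at 0, so the largest singular value is [singular_value M 0];
   it is 0 when m = 0 or n = 0. *)
Definition singular_value (R : realType) (m n : nat) (M : 'M[R]_(m, n))
    (j : nat) : R :=
  nth 0 (singular_values M) j.

Definition schatten_norm (R : realType) (m n : nat) (p : nat)
    (M : 'M[R]_(m, n)) : R :=
  (\sum_(j < minn m n) singular_value M j ^+ p) `^ (p%:R^-1).

Definition schatten_norm_infty (R : realType) (m n : nat)
    (M : 'M[R]_(m, n)) : R :=
  singular_value M 0.

(* Main.v *)
Require Import Defs.
From mathcomp Require Import all_boot all_order all_algebra all_fingroup.
From mathcomp Require Import reals exp polyrcf complex.
From mathcomp Require Import ring lra.

Set Implicit Arguments.
Unset Strict Implicit.
Unset Printing Implicit Defensive.

Import Order.TTheory GRing.Theory Num.Theory.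
Local Open Scope ring_scope.

(** The Schatten norms have a variational description that makes their
    properties immediate.  Call a matrix U a contraction when |U x| <= |x| for
    all x.  Then
      sum_j sigma_j(M)^p = max_(U, V) sum_i |(U M V^T)_ii|^p,
    the maximum being over contractions U, V with the same number of rows.

    Equality is reached at the singular vectors
    ([singular_value_decomposition]).  For the upper bound, write
    M = X^T D Y with D the diagonal of singular values; then
    (U M V^T)_ii = sum_j P_ij sigma_j Q_ij for the contractions P = U X^T and
    Q = V Y^T.  By the inequality of the arithmetic and geometric means
    |P_ij Q_ij| is at most W_ij = (P_ij^2 + Q_ij^2) / 2, and W is doubly
    substochastic because rows and columns of a contraction have norm at most
    1.  Jensen's inequality along the rows of W, and then summation along its
    columns, give the bound ([pinch_sum_pow], [singular_value_pinch]).

    Two consequences follow by evaluating at the singular vectors of the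
    matrix on the left-hand side.  The triangle inequality reduces to
    Minkowski's inequality for finite sums, since M |-> (U M V^T)_ii is
    linear.  And ||Q M|| <= ||M|| for every contraction Q, since U Q is again
    a contraction.  The case p = oo is the same argument with one diagonal
    entry in place of the sum.

    As I - P is a contraction, the theorem is the reverse triangle inequality
    for (I - P)(A + E) = (I - P) A + (I - P) E.

    The remaining work is the singular value decomposition itself, which
    rests on the real spectral theorem and on the identification of the roots
    of a characteristic polynomial, with their multiplicities, with the
    diagonal entries of a diagonalization. *)

(** * Power sums *)

Section PowerSums.
Variables (R : realFieldType) (I : finType).
Implicit Types a b w : I -> R.

(** Twice the difference of the two sides is the sum over i and j of
    w_i w_j (a_i - a_j) (a_i^k - a_j^k), whose terms are nonnegative because
    the power function is increasing. *)
Lemma chebyshev_sum w a k : (forall i, 0 <= w i) -> (forall i, 0 <= a i) ->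
  (\sum_i w i * a i) * (\sum_i w i * a i ^+ k) <=
  (\sum_i w i) * \sum_i w i * a i ^+ k.+1.
Proof.
move=> w0 a0; rewrite -subr_ge0 -(pmulr_rge0 _ (ltr0n _ 2)) mulr_natl mulr2n.
have -> : (\sum_i w i) * (\sum_i w i * a i ^+ k.+1)
          - (\sum_i w i * a i) * (\sum_i w i * a i ^+ k)
        = \sum_i \sum_j w i * w j * (a j ^+ k.+1 - a i * a j ^+ k).
  rewrite !big_distrlr -sumrB; apply: eq_bigr => i _; rewrite -sumrB.
  by apply: eq_bigr => j _ /=; ring.
rewrite {1}exchange_big -big_split; apply: sumr_ge0 => i _.
rewrite -big_split; apply: sumr_ge0 => j _ /=.
have -> : w j * w i * (a i ^+ k.+1 - a j * a i ^+ k)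
          + w i * w j * (a j ^+ k.+1 - a i * a j ^+ k)
        = w i * w j * ((a i - a j) * (a i ^+ k - a j ^+ k)).
  by rewrite !exprS; ring.
apply: mulr_ge0; first exact: mulr_ge0.
have [aij|/ltW aij] := leP (a i) (a j).
  by rewrite mulr_le0 // subr_le0 // lerXn2r ?nnegrE.
by rewrite mulr_ge0 // subr_ge0 // lerXn2r ?nnegrE.
Qed.

(** Jensen's inequality for x |-> x^(k+1) without normalization of the weights:
    a division-free form, which therefore also covers substochastic weights
    and weights that vanish. *)
Lemma jensen_pow w a k : (forall i, 0 <= w i) -> (forall i, 0 <= a i) ->
  (\sum_i w i * a i) ^+ k.+1 <=
  (\sum_i w i) ^+ k * \sum_i w i * a i ^+ k.+1.
Proof.
move=> w0 a0; elim: k => [|k IHk].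
  by rewrite expr0 mul1r expr1.
rewrite exprS; have S0 : 0 <= \sum_i w i * a i.
  by apply: sumr_ge0 => i _; rewrite mulr_ge0.
apply: le_trans (ler_wpM2l S0 IHk) _.
rewrite mulrCA exprSr -mulrA ler_wpM2l ?exprn_ge0 ?chebyshev_sum //.
exact: sumr_ge0.
Qed.

End PowerSums.

Lemma convex_pow (R : realFieldType) (s t x y : R) k :
  0 <= s -> 0 <= t -> 0 <= x -> 0 <= y ->
  (s * x + t * y) ^+ k.+1 <= (s + t) ^+ k * (s * x ^+ k.+1 + t * y ^+ k.+1).
Proof.
move=> s0 t0 x0 y0.
have := @jensen_pow R bool (fun b => if b then s else t)
  (fun b => if b then x else y) k.
by rewrite !big_bool; apply; case.
Qed.

Lemma root_powRK (R : realType) p (x : R) : (1 <= p)%N -> 0 <= x ->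
  (x `^ p%:R^-1) ^+ p = x.
Proof.
move=> p1 x0; rewrite -powR_mulrn ?powR_ge0 // -powRrM mulVf ?powRr1 //.
by rewrite pnatr_eq0 -lt0n.
Qed.

(** With s and t the two norms on the right, a_i + b_i is the combination of
    a_i / s and b_i / t with weights s and t; convexity bounds its power, and
    the power sums of a / s and b / t are at most 1. *)
Lemma minkowski_sum (R : realType) (I : finType) (a b : I -> R) p :
    (1 <= p)%N -> (forall i, 0 <= a i) -> (forall i, 0 <= b i) ->
  (\sum_i (a i + b i) ^+ p) `^ p%:R^-1 <=
  (\sum_i a i ^+ p) `^ p%:R^-1 + (\sum_i b i ^+ p) `^ p%:R^-1.
Proof.
move=> p1 a0 b0.
have sum0 (c : I -> R) : (forall i, 0 <= c i) -> 0 <= \sum_i c i ^+ p.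
  by move=> c0; apply: sumr_ge0 => i _; rewrite exprn_ge0.
set s := (\sum_i a i ^+ p) `^ _; set t := (\sum_i b i ^+ p) `^ _.
have s0 : 0 <= s by exact: powR_ge0.
have t0 : 0 <= t by exact: powR_ge0.
have unit_ball (c : I -> R) (r := (\sum_i c i ^+ p) `^ p%:R^-1) :
    (forall i, 0 <= c i) ->
    (forall i, c i = r * (c i / r)) /\ r * \sum_i (c i / r) ^+ p <= r.
  move=> c0; have rE : r ^+ p = \sum_i c i ^+ p by rewrite root_powRK ?sum0.
  (* When r = 0 all c i vanish, and the convention 0^-1 = 0 makes both claims
     true. *)
  have [r0|rN0] := eqVneq r 0.
    rewrite r0 mul0r lexx; split=> // i; apply/eqP; rewrite mul0r.
    have c0p j : true -> 0 <= c j ^+ p by move=> _; exact: exprn_ge0.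
    have /eqP : \sum_j c j ^+ p = 0 by rewrite -rE r0 expr0n gtn_eqF.
    rewrite psumr_eq0 // => /allP/(_ i (mem_index_enum i)).
    by rewrite expf_eq0 p1.
  split=> [i|]; first by rewrite mulrC divfK.
  under eq_bigr do rewrite expr_div_n.
  by rewrite -mulr_suml -rE divff ?mulr1 ?expf_neq0.
have [aE sa] := unit_ball a a0; have [bE tb] := unit_ball b b0.
rewrite -(@ler_pXn2r _ p) ?nnegrE ?powR_ge0 ?addr_ge0 // root_powRK //; last first.
  by apply: sum0 => i; rewrite addr_ge0.
case: p p1 @s @t => // k _ s t in sum0 s0 t0 unit_ball aE sa bE tb *.
apply: (@le_trans _ _ (\sum_i (s + t) ^+ k *
    (s * (a i / s) ^+ k.+1 + t * (b i / t) ^+ k.+1))).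
  apply: ler_sum => i _; rewrite {1}aE {1}bE.
  by apply: convex_pow => //; rewrite divr_ge0.
rewrite -mulr_sumr exprSr ler_wpM2l ?exprn_ge0 ?addr_ge0 //.
by rewrite big_split /= -!mulr_sumr lerD.
Qed.

(** * Contractions *)

Section Contractions.
Variable R : realFieldType.

Definition sqnorm n (x : 'cV[R]_n) : R := (x^T *m x) 0 0.

Definition contraction m n (U : 'M[R]_(m, n)) : Prop :=
  forall x : 'cV[R]_n, sqnorm (U *m x) <= sqnorm x.

Lemma sqnormE n (x : 'cV[R]_n) : sqnorm x = \sum_i x i 0 ^+ 2.
Proof. by rewrite /sqnorm mxE; apply: eq_bigr => i _; rewrite mxE. Qed.

Lemma sqnorm_col m n (A : 'M_(m, n)) i : sqnorm (col i A) = (A^T *m A) i i.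
Proof. by rewrite sqnormE mxE; apply: eq_bigr => k _; rewrite !mxE. Qed.

Lemma sqnorm_ge0 n (x : 'cV[R]_n) : 0 <= sqnorm x.
Proof. by rewrite sqnormE; apply: sumr_ge0 => i _; exact: sqr_ge0. Qed.

Lemma sqnorm_eq0 n (x : 'cV[R]_n) : sqnorm x = 0 -> x = 0.
Proof.
move/eqP; rewrite sqnormE psumr_eq0 => [/allP x0|i _]; last exact: sqr_ge0.
apply/colP => i; apply/eqP; rewrite mxE -sqrf_eq0; apply: x0.
by rewrite mem_index_enum.
Qed.

Lemma sqnorm_delta n (i : 'I_n) : sqnorm (delta_mx i 0) = 1.
Proof. by rewrite /sqnorm trmx_delta mul_delta_mx mxE !eqxx. Qed.

Lemma contraction_mul m n k (U : 'M_(m, n)) (V : 'M_(n, k)) :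
  contraction U -> contraction V -> contraction (U *m V).
Proof. by move=> cU cV x; rewrite -mulmxA; exact: le_trans (cU _) (cV _). Qed.

Lemma sqnormB n (x y : 'cV[R]_n) :
  sqnorm (x - y) = sqnorm x - (x^T *m y) 0 0 *+ 2 + sqnorm y.
Proof.
rewrite !sqnormE mxE -sumrMnl -sumrB -big_split; apply: eq_bigr => i _.
by rewrite !mxE sqrrB.
Qed.

(** Expanding 0 <= |y - U (U^T y)|^2 and using |U (U^T y)| <= |U^T y| leaves
    0 <= |y|^2 - |U^T y|^2. *)
Lemma contraction_tr m n (U : 'M_(m, n)) : contraction U -> contraction U^T.
Proof.
move=> cU y; have := sqnorm_ge0 (y - U *m (U^T *m y)); rewrite sqnormB.
have -> : (y^T *m (U *m (U^T *m y))) 0 0 = sqnorm (U^T *m y).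
  by rewrite /sqnorm trmx_mul trmxK !mulmxA.
have := cU (U^T *m y); lra.
Qed.

(** Expanding 0 <= |x - U^T (U x)|^2 gives |x|^2 - |U x|^2.  This single
    criterion covers orthogonal projectors, matrices with orthonormal rows,
    and matrices whose rows are orthonormal or zero. *)
Lemma partial_isometry_contraction m n (U : 'M_(m, n)) :
  U *m U^T *m U = U -> contraction U.
Proof.
move=> UUU x; have := sqnorm_ge0 (x - U^T *m (U *m x)); rewrite sqnormB.
have -> : (x^T *m (U^T *m (U *m x))) 0 0 = sqnorm (U *m x).
  by rewrite /sqnorm trmx_mul !mulmxA.
have -> : sqnorm (U^T *m (U *m x)) = sqnorm (U *m x).
  have UUUx : U *m (U^T *m (U *m x)) = U *m x by rewrite !mulmxA UUU.
  by rewrite /sqnorm trmx_mul trmxK -mulmxA UUUx.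
lra.
Qed.

Lemma contraction_sum_col m n (U : 'M_(m, n)) j :
  contraction U -> \sum_i U i j ^+ 2 <= 1.
Proof.
move=> cU; have := cU (delta_mx j 0).
rewrite sqnorm_delta sqnormE -colE.
by under eq_bigr do rewrite mxE.
Qed.

Lemma contraction_sum_row m n (U : 'M_(m, n)) i :
  contraction U -> \sum_j U i j ^+ 2 <= 1.
Proof.
move=> /contraction_tr /(contraction_sum_col i).
by under eq_bigr do rewrite mxE.
Qed.

(** * Diagonals of matrices between contractions *)

(** A doubly substochastic matrix when P and Q are contractions; by the
    inequality of the means it dominates the entries |P_ij Q_ij|. *)
Definition mean_sq m n (P Q : 'M[R]_(m, n)) i j := (P i j ^+ 2 + Q i j ^+ 2) / 2.

Lemma mean_sq_ge0 m n (P Q : 'M_(m, n)) i j : 0 <= mean_sq P Q i j.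
Proof. by rewrite divr_ge0 ?addr_ge0 ?sqr_ge0. Qed.

Lemma mean_sq_sum_row m n (P Q : 'M_(m, n)) i :
  contraction P -> contraction Q -> \sum_j mean_sq P Q i j <= 1.
Proof.
move=> /(contraction_sum_row i) cP /(contraction_sum_row i) cQ.
by rewrite -mulr_suml big_split /=; lra.
Qed.

Lemma mean_sq_sum_col m n (P Q : 'M_(m, n)) j :
  contraction P -> contraction Q -> \sum_i mean_sq P Q i j <= 1.
Proof.
move=> /(contraction_sum_col j) cP /(contraction_sum_col j) cQ.
by rewrite -mulr_suml big_split /=; lra.
Qed.

Lemma pinch_entry m n (P Q : 'M_(m, n)) (d : 'rV_n) i :
    (forall j, 0 <= d 0 j) ->
  `|(P *m diag_mx d *m Q^T) i i| <= \sum_j mean_sq P Q i j * d 0 j.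
Proof.
move=> d0; rewrite mxE; apply: le_trans (ler_norm_sum _ _ _) _.
apply: ler_sum => j _; rewrite mul_mx_diag !mxE mulrAC normrM (ger0_norm (d0 j)).
rewrite ler_wpM2r // ler_norml /mean_sq.
have := sqr_ge0 (P i j + Q i j); have := sqr_ge0 (P i j - Q i j).
by rewrite sqrrB sqrrD => *; apply/andP; split; lra.
Qed.

(** Jensen's inequality along the rows of the substochastic matrix
    [mean_sq P Q] turns the power of each diagonal entry into a weighted sum
    of the powers d_j^p; the total weight of each d_j^p is a column sum. *)
Lemma pinch_sum_pow m n (P Q : 'M_(m, n)) (d : 'rV_n) p :
    (1 <= p)%N -> (forall j, 0 <= d 0 j) -> contraction P -> contraction Q ->
  \sum_i `|(P *m diag_mx d *m Q^T) i i| ^+ p <= \sum_j d 0 j ^+ p.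
Proof.
case: p => // k _ d0 cP cQ.
apply: (@le_trans _ _ (\sum_i \sum_j mean_sq P Q i j * d 0 j ^+ k.+1)).
  apply: ler_sum => i _.
  have W0 j : 0 <= mean_sq P Q i j by exact: mean_sq_ge0.
  apply: (@le_trans _ _ ((\sum_j mean_sq P Q i j * d 0 j) ^+ k.+1)).
    by rewrite lerXn2r ?nnegrE ?pinch_entry ?sumr_ge0 // => j _; rewrite mulr_ge0.
  apply: le_trans (jensen_pow k W0 d0) _.
  rewrite ler_piMl ?exprn_ile1 ?mean_sq_sum_row ?sumr_ge0 //.
  by move=> j _; rewrite mulr_ge0 ?exprn_ge0.
rewrite exchange_big; apply: ler_sum => j _ /=; rewrite -mulr_suml.
by rewrite ler_piMl ?exprn_ge0 ?mean_sq_sum_col.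
Qed.

Lemma pinch_entry_le m n (P Q : 'M_(m, n)) (d : 'rV_n) b i :
    (forall j, 0 <= d 0 j <= b) -> 0 <= b -> contraction P -> contraction Q ->
  `|(P *m diag_mx d *m Q^T) i i| <= b.
Proof.
move=> db b0 cP cQ; apply: le_trans (pinch_entry _ _ _ _) _.
  by move=> j; case/andP: (db j).
apply: (@le_trans _ _ (\sum_j mean_sq P Q i j * b)).
  apply: ler_sum => j _; rewrite ler_wpM2l ?mean_sq_ge0 //.
  by case/andP: (db j).
by rewrite -mulr_suml ler_piMl ?mean_sq_sum_row.
Qed.

End Contractions.

(** * The real spectral theorem *)

Section SpectralTheorem.
Variable R : rcfType.

(** Take a complex eigenvector x + i y with eigenvalue a + i b.  Its real and
    imaginary parts satisfy x A = a x - b y and y A = a y + b x, so the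
    symmetry of A, x A y^T = y A x^T, forces b (|x|^2 + |y|^2) = 0. *)
Lemma symmetric_eigenvalue n (A : 'M[R]_n) : (0 < n)%N -> A^T = A ->
  exists a, eigenvalue A a.
Proof.
move=> n0 As; pose f := real_complex R.
have /closed_rootP[c] : size (char_poly (map_mx f A)) != 1%N.
  by rewrite size_char_poly eqSS -lt0n.
rewrite -eigenvalue_root_char => eig; move/eigenvalueP: (eig) => [v vA vN0].
case: c vA eig => a b vA eig.
pose x := \row_j complex.Re (v 0 j); pose y := \row_j complex.Im (v 0 j).
have entry j : (x *m A) 0 j = a * x 0 j - b * y 0 j
    /\ (y *m A) 0 j = a * y 0 j + b * x 0 j.
  have /rowP/(_ j) := vA; rewrite !mxE.
  have -> : \sum_k v 0 k * map_mx f A k j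
          = Complex (\sum_k x 0 k * A k j) (\sum_k y 0 k * A k j).
    elim/big_rec3: _ => [//|k s t z _ ->]; rewrite !mxE.
    by case: (v 0 k) => p q; apply/eqP; rewrite eq_complex /= !mulr0 subr0 add0r !eqxx.
  case: (v 0 j) => p q [-> ->] /=.
  by split; ring.
have xA : x *m A = a *: x - b *: y by apply/rowP => j; rewrite (entry j).1 !mxE.
have yA : y *m A = a *: y + b *: x by apply/rowP => j; rewrite (entry j).2 !mxE.
have sym : (x *m A *m y^T) 0 0 = (y *m A *m x^T) 0 0.
  by rewrite -[in RHS]As -{2}(trmxK y) -!trmx_mul [RHS]mxE mulmxA.
have b0 : b * (sqnorm x^T + sqnorm y^T) = 0.
  move: sym; rewrite xA yA /sqnorm !trmxK mulmxBl mulmxDl -!scalemxAl.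
  have -> : y *m x^T = x *m y^T.
    by apply/matrixP => i j; rewrite !ord1 -{1}(trmxK y) -trmx_mul mxE.
  by rewrite !mxE; lra.
move/eqP: b0; rewrite mulf_eq0 => /orP[/eqP b0|].
  by exists a; rewrite b0 in eig; rewrite -(eigenvalue_map f).
rewrite paddr_eq0 ?sqnorm_ge0 // => /andP[/eqP/sqnorm_eq0 x0 /eqP/sqnorm_eq0 y0].
case/eqP: vN0; apply/rowP => j; rewrite mxE.
move/colP/(_ j): x0; move/colP/(_ j): y0; rewrite !mxE.
by case: (v 0 j) => ? ? /= -> ->.
Qed.

(** The reflection that exchanges the first basis vector e and u; it is the
    identity when u = e. *)
Lemma householder n (u : 'rV[R]_n.+1) : u *m u^T = 1%:M ->
  exists2 H : 'M_n.+1, H *m H^T = 1%:M & delta_mx 0 0 *m H = u.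
Proof.
move=> u1; pose e := delta_mx 0 0 : 'rV[R]_n.+1; pose w := u - e.
pose c := (w *m w^T) 0 0.
have wwT : w *m w^T = c%:M by exact: mx11_scalar.
have ee : e *m e^T = 1%:M.
  by rewrite trmx_delta mul_delta_mx; apply/matrixP => i j; rewrite !ord1 !mxE.
have [c0|cN0] := eqVneq c 0.
  have w0 : w = 0.
    by apply: trmx_inj; rewrite trmx0; apply: sqnorm_eq0; rewrite /sqnorm trmxK.
  exists 1%:M; first by rewrite trmx1 mulmx1.
  by rewrite mulmx1; move/eqP: w0; rewrite subr_eq0 => /eqP.
pose K := w^T *m w.
have KT : K^T = K by rewrite trmx_mul trmxK.
have KK : K *m K = c *: K by rewrite mulmxA -(mulmxA w^T w) wwT mul_mx_scalar -scalemxAl.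
exists (1%:M - (2 / c) *: K).
  have -> : (1%:M - (2 / c) *: K)^T = 1%:M - (2 / c) *: K.
    by rewrite [LHS]linearB /= [in LHS]linearZ /= trmx1 KT.
  rewrite mulmxBl mul1mx mulmxBr mulmx1 -scalemxAl -scalemxAr KK.
  rewrite [_ *: (c *: K)]scalerA divfK //.
  by rewrite scaler_nat mulr2n scalerDr opprB addrK subrK.
have ew : e *m w^T = (- (c / 2))%:M.
  have wE : w *m w^T = 2 *: (1%:M - e *m u^T).
    have ue : u *m e^T = e *m u^T.
      by rewrite -[LHS]trmxK trmx_mul trmxK; apply/matrixP => i j; rewrite !ord1 mxE.
    rewrite [w^T]linearB /= mulmxBl !mulmxBr u1 ee ue.
    by rewrite scalerBr !scaler_nat !mulr2n opprB addrACA -opprD.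
  have -> : e *m w^T = - (2^-1 *: (w *m w^T)).
    by rewrite wE scalerA mulVf ?pnatr_eq0 // scale1r opprB [w^T]linearB /= mulmxBr ee.
  by rewrite wwT scale_scalar_mx -raddfN mulrC.
rewrite mulmxBr mulmx1 -scalemxAr mulmxA -/e ew mul_scalar_mx scalerA.
have -> : 2 / c * - (c / 2) = -1 by field.
by rewrite scaleN1r opprK addrC subrK.
Qed.

(** Induction on n: an orthogonal change of basis that sends the first basis
    vector to a unit eigenvector makes the first row of A a multiple of that
    basis vector, and by symmetry the first column too. *)
Theorem symmetric_diagonalization n (A : 'M[R]_n) : A^T = A ->
  exists (V : 'M_n) (d : 'rV_n),
    V *m V^T = 1%:M /\ A = V^T *m diag_mx d *m V.
Proof.
elim: n A => [|n IHn] A As.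
  by exists 1%:M, 0; split; apply/matrixP; case.
have [a /eigenvalueP[v vA vN0]] := symmetric_eigenvalue (ltn0Sn n) As.
have vv0 : 0 < sqnorm v^T.
  rewrite lt_def sqnorm_ge0 andbT; apply: contraNneq vN0 => /sqnorm_eq0 v0.
  by rewrite -(trmxK v) v0 trmx0.
pose u := (Num.sqrt (sqnorm v^T))^-1 *: v.
have uA : u *m A = a *: u by rewrite -scalemxAl vA !scalerA mulrC.
have [|H HHT eH] := @householder _ u.
  rewrite linearZ /= -scalemxAl -scalemxAr scalerA -expr2 exprVn sqr_sqrtr ?ltW //.
  have -> : v *m v^T = (sqnorm v^T)%:M by rewrite [LHS]mx11_scalar /sqnorm trmxK.
  by rewrite scale_scalar_mx mulVf ?gt_eqF.
have HTH : H^T *m H = 1%:M by exact: mulmx1C.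
pose B : 'M_(1 + n) := H *m A *m H^T.
have Bs : B^T = B by rewrite /B !trmx_mul trmxK As mulmxA.
have eB : delta_mx 0 0 *m B = a *: (delta_mx 0 0 : 'rV_n.+1).
  by rewrite /B !mulmxA eH uA -scalemxAl -eH -mulmxA HHT mulmx1.
have AB : A = H^T *m B *m H by rewrite /B !mulmxA HTH mul1mx -mulmxA HTH mulmx1.
clearbody B.
have B0 i j : i = 0 -> B i j = a * (j == 0)%:R.
  move=> ->; have := congr1 (fun M : 'rV_n.+1 => M 0 j) eB.
  by rewrite /= -rowE !mxE !eqxx.
have [|W [d [WW BE]]] := IHn (drsubmx B).
  by rewrite trmx_drsub Bs.
have Bblock : B = block_mx a%:M 0 0 (drsubmx B).
  rewrite -[LHS]submxK; congr block_mx.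
  - by rewrite [LHS]mx11_scalar !mxE B0 ?mulr1 //; apply/val_inj.
  - by apply/rowP => j; rewrite !mxE B0 ?mulr0 //; apply/val_inj.
  - by apply/colP => j; rewrite !mxE -Bs mxE B0 ?mulr0 //; apply/val_inj.
pose C : 'M_(1 + n) := block_mx 1%:M 0 0 W.
have CT : C^T = block_mx 1%:M 0 0 W^T by rewrite tr_block_mx !trmx0 trmx1.
have CC : C *m C^T = 1%:M.
  rewrite CT mulmx_block !mul0mx !mulmx0 !addr0 !add0r WW mulmx1.
  by rewrite -scalar_mx_block.
have BC : B = C^T *m diag_mx (row_mx a%:M d) *m C.
  rewrite CT diag_mx_row !mulmx_block !mul0mx !mulmx0 !addr0 !add0r.
  rewrite !mul0mx !mul1mx !mulmx1 -BE [LHS]Bblock; congr block_mx.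
  by apply/matrixP => i j; rewrite !ord1 !mxE.
clearbody C; exists (C *m H : 'M_n.+1); exists (row_mx a%:M d : 'rV_n.+1); split.
  by rewrite trmx_mul mulmxA -(mulmxA C) HHT mulmx1.
by rewrite trmx_mul AB BC !mulmxA.
Qed.

End SpectralTheorem.

(** * Singular values *)

Section SingularValues.
Variable R : realType.

Lemma mup_prod_XsubC (s : seq R) x :
  mup x (\prod_(y <- s) ('X - y%:P)) = count_mem x s.
Proof.
elim: s => [|y s IHs]; first by rewrite big_nil mupNroot ?root1.
rewrite big_cons mupM ?polyXsubC_eq0 //; last first.
  by rewrite monic_neq0 ?monic_prod_XsubC.
by rewrite IHs -['X - _]expr1 mup_XsubCX /=; case: eqP.
Qed.

(** When the characteristic polynomial splits, the multiplicity of x in either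
    list is the multiplicity of x as a root of that polynomial. *)
Lemma real_eigenvalues_perm n (A : 'M[R]_n) (s : seq R) :
    char_poly A = \prod_(y <- s) ('X - y%:P) ->
  perm_eq (real_eigenvalues A) s.
Proof.
move=> pE; have p0 : char_poly A != 0 by rewrite monic_neq0 ?char_poly_monic.
have mem_roots x : (x \in rootsR (char_poly A)) = root (char_poly A) x.
  by apply/esym; apply: (roots_onP (roots_on_rootsR p0)); rewrite in_itv.
have uniqr : uniq (rootsR (char_poly A)) by exact: uniq_roots.
apply/allP => x _ /=; apply/eqP; rewrite count_flatten -map_comp sumnE big_map.
under eq_bigr do rewrite /= count_nseq.
rewrite -mup_prod_XsubC -pE.
have [xr|xNr] := boolP (x \in rootsR (char_poly A)).
  rewrite (bigD1_seq x) //= eqxx mul1n big1 ?addn0 // => y /negPf ->.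
  by rewrite mul0n.
rewrite big1_seq => [|y /andP[_ yr]]; first by rewrite mupNroot // -mem_roots.
by move=> /=; case: (eqVneq y x) yr xNr => [-> ->|].
Qed.

Lemma real_eigenvalues_sorted n (A : 'M[R]_n) :
  sorted <=%R (real_eigenvalues A).
Proof.
rewrite /real_eigenvalues; have : sorted <%R (rootsR (char_poly A)).
  exact: sorted_roots.
rewrite lt_sorted_pairwise sorted_pairwise; last exact: le_trans.
elim: (rootsR _) => //= x s IHs /andP[/allP xs /IHs {}IHs].
rewrite pairwise_cat IHs andbT; apply/andP; split.
  apply/allrelP => y z /nseqP[-> _] /flatten_mapP[w ws /nseqP[-> _]].
  exact/ltW/xs.
by elim: (mup _ _) => //= k ->; rewrite all_nseq lexx orbT.
Qed.

Lemma sqrt_eigenvalues_sorted n (A : 'M[R]_n) :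
  sorted >=%R (rev [seq Num.sqrt x | x <- real_eigenvalues A]).
Proof.
rewrite rev_sorted; apply: homo_sorted (real_eigenvalues_sorted _) => x y.
exact: ler_wsqrtr.
Qed.

Let ge_trans : transitive (>=%R : rel R).
Proof. by move=> x y z yx zy; exact: le_trans zy yx. Qed.

Let ge_refl : reflexive (>=%R : rel R).
Proof. by move=> x; exact: lexx. Qed.

Lemma singular_value_ge0 m n (M : 'M[R]_(m, n)) j : 0 <= singular_value M j.
Proof.
have [js|js] := ltnP j (size (singular_values M)); last first.
  by rewrite /singular_value nth_default.
have /mem_take : singular_value M j \in singular_values M by exact: mem_nth.
by rewrite mem_rev => /mapP[x _ ->]; exact: sqrtr_ge0.
Qed.

Lemma singular_value_le_first m n (M : 'M[R]_(m, n)) j :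
  singular_value M j <= singular_value M 0.
Proof.
have [js|js] := ltnP j (size (singular_values M)); last first.
  by rewrite {1}/singular_value nth_default // singular_value_ge0.
apply: (sorted_leq_nth ge_trans ge_refl) => //.
  exact/take_sorted/sqrt_eigenvalues_sorted.
by rewrite inE (leq_ltn_trans _ js).
Qed.

Lemma char_poly_diag_conj n (V : 'M[R]_n) (d : 'rV_n) :
    V *m V^T = 1%:M ->
  char_poly (V^T *m diag_mx d *m V) = \prod_(y <- [seq d 0 i | i : 'I_n]) ('X - y%:P).
Proof.
move=> VVT; have VTV : V^T *m V = 1%:M by exact: mulmx1C.
rewrite big_map big_enum /=.
have -> : \prod_i ('X - (d 0 i)%:P) = char_poly (diag_mx d).
  rewrite char_poly_trig; last first.
    by apply/is_trig_mxP => i j ij; rewrite mxE lt_eqF.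
  by apply: eq_bigr => i _; rewrite mxE eqxx.
have E : char_poly_mx (V^T *m diag_mx d *m V) =
    map_mx polyC V^T *m char_poly_mx (diag_mx d) *m map_mx polyC V.
  rewrite /char_poly_mx mulmxBr mulmxBl !map_mxM; congr (_ - _).
  by rewrite mul_mx_scalar -scalemxAl -map_mxM VTV map_mx1 scalemx1.
rewrite /char_poly E !det_mulmx mulrAC -det_mulmx -map_mxM VTV map_mx1 det1.
by rewrite mul1r.
Qed.

(** The matrix V is a diagonalizing basis of M^T M whose vectors are permuted so
    that the square roots s of the eigenvalues decrease.  The restriction to
    indices below m reflects that the list of singular values stops at
    min(m, n); the s_i with i >= m will turn out to be 0. *)
Lemma gram_diagonalization m n (M : 'M[R]_(m, n)) :
  exists (V : 'M_n) (s : 'I_n -> R),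
    [/\ V *m V^T = 1%:M,
        V *m (M^T *m M) *m V^T = diag_mx (\row_i s i ^+ 2),
        forall i, 0 <= s i,
        forall i j : 'I_n, (i <= j)%N -> s j <= s i &
        forall i : 'I_n, (i < m)%N -> singular_value M i = s i].
Proof.
have [|V0 [d [VV ME]]] := @symmetric_diagonalization R n (M^T *m M).
  by rewrite trmx_mul trmxK.
pose sq := rev [seq Num.sqrt x | x <- real_eigenvalues (M^T *m M)].
have sq_perm : perm_eq sq (mktuple (fun i => Num.sqrt (d 0 i))).
  rewrite perm_rev /= [X in perm_eq _ X](map_comp (@Num.sqrt R) (fun i => d 0 i)).
  by apply/perm_map/real_eigenvalues_perm; rewrite ME char_poly_diag_conj.
have sq_sorted : sorted >=%R sq by exact: sqrt_eigenvalues_sorted.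
have sq_size : size sq = n by rewrite (perm_size sq_perm) size_tuple.
have [q sqE] := tuple_permP sq_perm.
have sq_nth (i : 'I_n) : nth 0 sq i = Num.sqrt (d 0 (q i)).
  by rewrite sqE -tnth_nth !tnth_mktuple.
have VMV : V0 *m (M^T *m M) *m V0^T = diag_mx d.
  by rewrite ME !mulmxA VV mul1mx -mulmxA VV mulmx1.
have d0 i : 0 <= d 0 i.
  have -> : d 0 i = sqnorm (col i (M *m V0^T)).
    by rewrite sqnorm_col trmx_mul trmxK mulmxA -(mulmxA V0) VMV mxE eqxx.
  exact: sqnorm_ge0.
exists (rowsub q V0), (fun i => nth 0 sq i); split=> [||i|i j ij|i im].
- rewrite trmx_mxsub -mxsub_mul VV; apply/matrixP => i j.
  by rewrite !mxE (inj_eq perm_inj).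
- rewrite trmx_mxsub mul_rowsub_mx -mxsub_mul VMV; apply/matrixP => i j.
  by rewrite !mxE (inj_eq perm_inj) sq_nth sqr_sqrtr.
- by rewrite sq_nth sqrtr_ge0.
- by apply: (sorted_leq_nth ge_trans ge_refl 0 sq_sorted); rewrite ?inE ?sq_size.
- by rewrite /singular_value /singular_values nth_take // leq_min im ltn_ord.
Qed.

(** The right singular vectors V are the first min(m, n) diagonalizing vectors v_j
    of M^T M, and the left ones are M v_j / sigma_j.  With 0^-1 = 0 the latter
    vanish when sigma_j = 0, so the rows of U are orthonormal or zero and U is still
    a contraction. *)
Lemma singular_value_decomposition m n (M : 'M[R]_(m, n))
    (D := diag_mx (\row_(j < minn m n) singular_value M j)) :
  exists (U : 'M_(minn m n, m)) (V : 'M_(minn m n, n)),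
    [/\ contraction U, contraction V, M = U^T *m D *m V
      & U *m M *m V^T = D].
Proof.
have [V [s [VV VMV s0 s_mono sE]]] := gram_diagonalization M.
have VTV : V^T *m V = 1%:M by exact: mulmx1C.
pose X k (f : 'I_k -> 'I_n) :=
  diag_mx (\row_j (s (f j))^-1) *m (rowsub f V *m M^T).
have gram_sub k (f : 'I_k -> 'I_n) : injective f ->
    rowsub f V *m M^T *m M *m (rowsub f V)^T = diag_mx (\row_j s (f j) ^+ 2).
  move=> f_inj; rewrite trmx_mxsub mul_rowsub_mx mul_rowsub_mx -mxsub_mul -(mulmxA V) VMV.
  by apply/matrixP => i j; rewrite !mxE (inj_eq f_inj).
have XX k (f : 'I_k -> 'I_n) : injective f ->
    X k f *m (X k f)^T = diag_mx (\row_j (s (f j) != 0)%:R).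
  move=> f_inj; rewrite /X !trmx_mul trmxK tr_diag_mx !mulmxA -(mulmxA (diag_mx _)).
  rewrite -(mulmxA (diag_mx _)) -(mulmxA (diag_mx _)) gram_sub // !mulmx_diag.
  congr diag_mx; apply/rowP => j; rewrite !mxE.
  by case: eqVneq => [->|sN0]; [rewrite invr0 mul0r mulr0|rewrite /=; field].
(* If s_i > 0 then M v_0 / s_0, ..., M v_i / s_i are orthonormal vectors of
   dimension m, so that i < m. *)
have s_tail (i : 'I_n) : (m <= i)%N -> s i = 0.
  move=> mi; apply/eqP; apply: contraLR mi => si; rewrite -ltnNge.
  pose f := widen_ord (ltn_ord i).
  have f_inj : injective f by move=> a b /(congr1 val) /= /val_inj.
  apply: (@mulmx1_min R _ _ (X _ f) (X _ f)^T); rewrite XX //.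
  apply/matrixP => a b; rewrite !mxE.
  suff -> : s (f a) != 0 by [].
  rewrite gt_eqF // (lt_le_trans _ (s_mono (f a) i _)) //=.
    by rewrite lt_def si s0.
  by rewrite -ltnS.
pose f := widen_ord (geq_minr m n).
have f_inj : injective f by move=> a b /(congr1 val) /= /val_inj.
have DE : D = diag_mx (\row_j s (f j)).
  congr diag_mx; apply/rowP => j; rewrite !mxE -sE //=.
  by rewrite (leq_trans (ltn_ord j)) // geq_minl.
pose W := rowsub f V.
have WW : W *m W^T = 1%:M.
  rewrite trmx_mxsub -mxsub_mul VV; apply/matrixP => i j.
  by rewrite !mxE (inj_eq f_inj).
have MV0 (i : 'I_n) a : s i = 0 -> (M *m V^T) a i = 0.
  move=> si; suff /colP/(_ a) : col i (M *m V^T) = 0 by rewrite !mxE.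
  apply: sqnorm_eq0; rewrite sqnorm_col trmx_mul trmxK mulmxA -(mulmxA V) VMV.
  by rewrite !mxE eqxx si expr0n.
have MWW : M *m W^T *m W = M.
  rewrite -[RHS]mulmx1 -VTV mulmxA; apply/matrixP => a b.
  rewrite !mxE [RHS](bigID (fun i : 'I_n => (i < minn m n)%N)) /=.
  rewrite [X in _ + X]big1 ?addr0 => [|i]; last first.
    rewrite leq_min ltn_ord andbT -leqNgt => mi.
    by rewrite MV0 ?mul0r // s_tail.
  rewrite (big_ord_narrow (geq_minr m n)); apply: eq_bigr => j _.
  by rewrite trmx_mxsub mulmx_colsub !mxE.
exists (X _ f), W; split.
- apply: partial_isometry_contraction; rewrite XX // /X mulmxA mulmx_diag.
  congr (diag_mx _ *m _); apply/rowP => j; rewrite !mxE.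
  by case: eqVneq => [->|_]; rewrite ?invr0 ?mul0r ?mul1r.
- by apply: partial_isometry_contraction; rewrite WW mul1mx.
- rewrite DE /X !trmx_mul trmxK tr_diag_mx -!mulmxA (mulmxA (diag_mx _)) mulmx_diag.
  rewrite !mulmxA -[LHS]MWW; congr (_ *m _); rewrite mul_mx_diag.
  apply/matrixP => a j; rewrite [RHS]mxE trmx_mxsub mulmx_colsub !mxE.
  case: (eqVneq (s (f j)) 0) => [sj|sj]; last by rewrite mulVf ?mulr1.
  by have := MV0 _ a sj; rewrite mxE => ->; rewrite mul0r.
- have := gram_sub _ f f_inj; rewrite DE /X -!mulmxA => ->.
  rewrite mulmx_diag; congr diag_mx; apply/rowP => j; rewrite !mxE.
  by case: (eqVneq (s (f j)) 0) => [->|?]; [rewrite invr0 mul0r|field].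
Qed.

(** The decomposition M = X^T D Y absorbs X and Y into the contractions on both
    sides: U M V^T = (U X^T) D (V Y^T)^T. *)
Lemma singular_value_pinch k m n p (U : 'M_(k, m)) (V : 'M_(k, n))
    (M : 'M[R]_(m, n)) :
    (1 <= p)%N -> contraction U -> contraction V ->
  \sum_i `|(U *m M *m V^T) i i| ^+ p
    <= \sum_(j < minn m n) singular_value M j ^+ p.
Proof.
move=> p1 cU cV; have [X [Y [cX cY ME _]]] := singular_value_decomposition M.
set d := \row_j _ in ME.
have -> : U *m M *m V^T = (U *m X^T) *m diag_mx d *m (V *m Y^T)^T.
  by rewrite trmx_mul trmxK {1}ME !mulmxA.
rewrite [leRHS](eq_bigr (fun j => d 0 j ^+ p)) => [|j _]; last by rewrite mxE.
apply: pinch_sum_pow => // [j||]; first by rewrite mxE singular_value_ge0.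
  exact/contraction_mul/contraction_tr.
exact/contraction_mul/contraction_tr.
Qed.

Lemma singular_value_pinch_entry k m n (U : 'M_(k, m)) (V : 'M_(k, n))
    (M : 'M[R]_(m, n)) i :
    contraction U -> contraction V ->
  `|(U *m M *m V^T) i i| <= singular_value M 0.
Proof.
move=> cU cV; have [X [Y [cX cY ME _]]] := singular_value_decomposition M.
set d := \row_j _ in ME.
have -> : U *m M *m V^T = (U *m X^T) *m diag_mx d *m (V *m Y^T)^T.
  by rewrite trmx_mul trmxK {1}ME !mulmxA.
apply: pinch_entry_le => [j|||].
- by rewrite mxE singular_value_ge0 singular_value_le_first.
- exact: singular_value_ge0.
- exact/contraction_mul/contraction_tr.
- exact/contraction_mul/contraction_tr.
Qed.

Lemma singular_values_attained m n (M : 'M[R]_(m, n)) :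
  exists (U : 'M_(minn m n, m)) (V : 'M_(minn m n, n)),
    [/\ contraction U, contraction V
      & forall j : 'I_(minn m n), singular_value M j = (U *m M *m V^T) j j].
Proof.
have [U [V [cU cV _ UMV]]] := singular_value_decomposition M.
by exists U, V; split=> // j; rewrite UMV !mxE eqxx.
Qed.

Lemma singular_valueN m n (M : 'M[R]_(m, n)) :
  singular_value (- M) =1 singular_value M.
Proof.
have NM : (- M)^T *m - M = M^T *m M by rewrite [(- M)^T]linearN mulNmx mulmxN opprK.
by move=> j; rewrite /singular_value /singular_values NM.
Qed.

End SingularValues.

(** * Schatten norms *)

Section SchattenNorms.
Variable R : realType.

(** The upper bound of the variational characterization, after the p-th root. *)
Lemma schatten_norm_ge k m n p (U : 'M_(k, m)) (V : 'M_(k, n))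
    (M : 'M[R]_(m, n)) :
    (1 <= p)%N -> contraction U -> contraction V ->
  (\sum_i `|(U *m M *m V^T) i i| ^+ p) `^ p%:R^-1 <= schatten_norm p M.
Proof.
move=> p1 cU cV; apply: ge0_ler_powR; rewrite ?invr_ge0 ?nnegrE //.
- by apply: sumr_ge0 => i _; exact: exprn_ge0.
- by apply: sumr_ge0 => i _; rewrite exprn_ge0 ?singular_value_ge0.
- exact: singular_value_pinch.
Qed.

(** At singular vectors U, V of M + N the diagonal of U (M + N) V^T is the sum
    of those of U M V^T and U N V^T, to which Minkowski's inequality applies. *)
Lemma schatten_norm_triangle m n p (M N : 'M[R]_(m, n)) : (1 <= p)%N ->
  schatten_norm p (M + N) <= schatten_norm p M + schatten_norm p N.
Proof.
move=> p1; have [U [V [cU cV svE]]] := singular_values_attained (M + N).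
pose a i := `|(U *m M *m V^T) i i|; pose b i := `|(U *m N *m V^T) i i|.
have a0 i : 0 <= a i by exact: normr_ge0.
have b0 i : 0 <= b i by exact: normr_ge0.
apply: (@le_trans _ _ ((\sum_i (a i + b i) ^+ p) `^ p%:R^-1)).
  apply: ge0_ler_powR; rewrite ?invr_ge0 ?nnegrE //.
  - by apply: sumr_ge0 => i _; rewrite exprn_ge0 ?singular_value_ge0.
  - by apply: sumr_ge0 => i _; rewrite exprn_ge0 ?addr_ge0.
  apply: ler_sum => i _.
  rewrite lerXn2r ?nnegrE ?addr_ge0 ?singular_value_ge0 // svE.
  by apply: le_trans (ler_norm _) _; rewrite mulmxDr mulmxDl mxE ler_normD.
apply: le_trans (minkowski_sum _ _ _) _ => //.
by rewrite lerD ?schatten_norm_ge.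
Qed.

(** At singular vectors U, V of Q M the diagonal of U (Q M) V^T is also that of
    (U Q) M V^T, where U Q is a contraction. *)
Lemma schatten_norm_contraction k m n p (Q : 'M_(k, m)) (M : 'M[R]_(m, n)) :
  (1 <= p)%N -> contraction Q -> schatten_norm p (Q *m M) <= schatten_norm p M.
Proof.
move=> p1 cQ; have [U [V [cU cV svE]]] := singular_values_attained (Q *m M).
apply: le_trans (schatten_norm_ge M p1 (contraction_mul cU cQ) cV).
rewrite le_eqVlt; apply/orP; left; apply/eqP; congr (_ `^ _).
apply: eq_bigr => i _; rewrite -(mulmxA U) -svE.
by rewrite ger0_norm ?singular_value_ge0.
Qed.

Lemma schatten_normN m n p (M : 'M[R]_(m, n)) :
  schatten_norm p (- M) = schatten_norm p M.
Proof.
by congr (_ `^ _); apply: eq_bigr => j _; rewrite singular_valueN.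
Qed.

(** An empty matrix has the default value 0 as its first singular value, which
    is why b must be nonnegative. *)
Lemma schatten_norm_infty_le m n (M : 'M[R]_(m, n)) b : 0 <= b ->
  (forall j : 'I_(minn m n), singular_value M j <= b) ->
  schatten_norm_infty M <= b.
Proof.
rewrite /schatten_norm_infty => b0 bM.
have [r0|r0] := posnP (minn m n); last exact: (bM (Ordinal r0)).
by rewrite /singular_value /singular_values r0 take0.
Qed.

Lemma schatten_norm_infty_triangle m n (M N : 'M[R]_(m, n)) :
  schatten_norm_infty (M + N) <= schatten_norm_infty M + schatten_norm_infty N.
Proof.
have [U [V [cU cV svE]]] := singular_values_attained (M + N).
apply: schatten_norm_infty_le => [|j]; first by rewrite addr_ge0 ?singular_value_ge0.
rewrite svE mulmxDr mulmxDl mxE; apply: le_trans (ler_norm _) _.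
by apply: le_trans (ler_normD _ _) _; rewrite lerD ?singular_value_pinch_entry.
Qed.

Lemma schatten_norm_infty_contraction k m n (Q : 'M_(k, m)) (M : 'M[R]_(m, n)) :
  contraction Q -> schatten_norm_infty (Q *m M) <= schatten_norm_infty M.
Proof.
move=> cQ; have [U [V [cU cV svE]]] := singular_values_attained (Q *m M).
apply: schatten_norm_infty_le => [|j]; first exact: singular_value_ge0.
rewrite svE mulmxA; apply: le_trans (ler_norm _) _.
by apply: singular_value_pinch_entry => //; exact: contraction_mul.
Qed.

Lemma schatten_norm_inftyN m n (M : 'M[R]_(m, n)) :
  schatten_norm_infty (- M) = schatten_norm_infty M.
Proof. exact: singular_valueN. Qed.

End SchattenNorms.

Lemma reverse_triangle (R : realDomainType) (V : zmodType) (f : V -> R) x y :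
    (forall u v, f (u + v) <= f u + f v) -> (forall u, f (- u) = f u) ->
  `|f (x + y) - f x| <= f y.
Proof.
move=> fD fN; rewrite ler_norml lerBlDl fD andbT lerBrDl lerBlDr.
by rewrite -(fN y) -{1}(addrK y x) fD.
Qed.

Lemma orth_projector_compl_contraction (R : realType) m (P : 'M[R]_m) :
  P *m P = P -> P^T = P -> contraction (1%:M - P).
Proof.
move=> PP PT; apply: partial_isometry_contraction.
have QQ : (1%:M - P) *m (1%:M - P) = 1%:M - P.
  by rewrite mulmxBl mul1mx mulmxBr mulmx1 PP subrr subr0.
have -> : (1%:M - P)^T = 1%:M - P by rewrite [LHS]linearB /= trmx1 PT.
by rewrite !QQ.
Qed.

Theorem theorem2 (R : realType) (m n : nat) (A E : 'M[R]_(m, n)) (P : 'M[R]_m)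
    (P_idem : P *m P = P) (P_sym : P^T = P) :
  (forall p : nat, (1 <= p)%N ->
    `| schatten_norm p ((1%:M - P) *m (A + E))
       - schatten_norm p ((1%:M - P) *m A) | <= schatten_norm p E) /\
  `| schatten_norm_infty ((1%:M - P) *m (A + E))
     - schatten_norm_infty ((1%:M - P) *m A) | <= schatten_norm_infty E.
Proof.
have cQ := orth_projector_compl_contraction P_idem P_sym.
rewrite mulmxDr; split=> [p p1|].
  apply: le_trans (schatten_norm_contraction E p1 cQ).
  apply: reverse_triangle => [M N|M]; last exact: schatten_normN.
  exact: schatten_norm_triangle.
apply: le_trans (schatten_norm_infty_contraction E cQ).
apply: reverse_triangle => [M N|M]; last exact: schatten_norm_inftyN.
exact: schatten_norm_infty_triangle.
Qed.
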